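(* Let $(\Lambda_1,\phi_1)$ and $(\Lambda_2,\phi_2)$ be topological flows on compact metric spaces. Suppose that there is a continuous surjection $P:\Lambda_1\to\Lambda_2$ such that $P(\phi_1(t,x))=\phi_2(t,P(x))$ for all $t\in\mathbb{R}$ and $x\in\Lambda_1$. Suppose further that there exists a closed orbit $\gamma\subset\Lambda_1$ of $\phi_1$ such that $P(\gamma)$ is a singularity of $\phi_2$ and the restriction of $P$ to $\Lambda_1\setminus\gamma$ is a bijection onto $\Lambda_2\setminus P(\gamma)$. If $\phi_1$ has the standard shadowing property, then $\phi_2$ has the standard shadowing property.
   Context: A topological flow $(\Lambda,\phi)$ is a continuous flow $\phi:\mathbb{R}\times\Lambda\to\Lambda$ on a compact metric space $(\Lambda,\mathrm{dist})$. A singularity is a fixed point of the flow (''$P(\gamma)$ is a singularity'' means $P(\gamma)$ is a single point fixed by $\phi_2$). A closed orbit is a periodic orbit with positive minimal period (not a fixed point). For $d>0$, a map $\xi:\mathbb{R}\to\Lambda$ (no continuity is required) is a $d$-pseudotrajectory of $\phi$ if $\mathrm{dist}(\xi(t+s),\phi(s,\xi(t)))<d$ for all $t\in\mathbb{R}$ and $s\in[0,1]$. Let $\mathrm{Rep}$ be the set of all orientation-preserving homeomorphisms $\mathbb{R}\to\mathbb{R}$, and for $\varepsilon>0$ let $$\mathrm{Rep}(\varepsilon)=\left\{f\in\mathrm{Rep} : \left|\frac{f(a)-f(b)}{a-b}-1\right|<\varepsilon \text{ for all } a,b\in\mathbb{R},\ a>b\right\}.$$ The flow $\phi$ has the standard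 shadowing property (on $\Lambda$) if for every $\varepsilon>0$ there exists $d>0$ such that for every $d$-pseudotrajectory $\xi$ of $\phi$ there exist $x\in\Lambda$ and $h\in\mathrm{Rep}(\varepsilon)$ with $\mathrm{dist}(\xi(t),\phi(h(t),x))<\varepsilon$ for all $t\in\mathbb{R}$. *)

(* Defs.v *)
From mathcomp Require Import all_boot all_order all_algebra.
From mathcomp Require Import boolp classical_sets functions reals.
From mathcomp Require Import topology normedtype.

Set Implicit Arguments.
Unset Strict Implicit.
Unset Printing Implicit Defensive.

Import Order.TTheory GRing.Theory Num.Theory.
Import numFieldNormedType.Exports.

Local Open Scope classical_set_scope.
Local Open Scope ring_scope.

(* Continuity is joint continuity on R * X with the product topology. *)
Definition is_flow (R : realType) (X : metricType R) (phi : R -> X -> X) : Prop :=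
  [/\ continuous (fun p : R * X => phi p.1 p.2),
      forall x, phi 0 x = x
    & forall t s x, phi (t + s) x = phi t (phi s x)].

Definition topological_flow (R : realType) (X : metricType R)
    (phi : R -> X -> X) : Prop :=
  compact [set: X] /\ is_flow phi.

Definition singularity (R : realType) (X : metricType R) (phi : R -> X -> X)
    (p : X) : Prop :=
  forall t, phi t p = p.

Definition flow_orbit (R : realType) (X : metricType R) (phi : R -> X -> X)
    (x : X) : set X :=
  [set phi t x | t in [set: R]].

Definition minimal_period (R : realType) (X : metricType R) (phi : R -> X -> X)
    (x : X) (T : R) : Prop :=
  [/\ 0 < T, phi T x = x & forall s, 0 < s -> phi s x = x -> T <= s].

Definition closed_orbit (R : realType) (X : metricType R) (phi : R -> X -> X)
    (gamma : set X) : Prop :=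
  exists x : X, gamma = flow_orbit phi x /\ exists T : R, minimal_period phi x T.

Definition pseudotrajectory (R : realType) (X : metricType R)
    (phi : R -> X -> X) (d : R) (xi : R -> X) : Prop :=
  forall t s : R, 0 <= s <= 1 -> mdist (xi (t + s)) (phi s (xi t)) < d.

Definition homeomorphism (X Y : topologicalType) (f : X -> Y) : Prop :=
  continuous f /\
  exists g : Y -> X, [/\ continuous g, cancel f g & cancel g f].

(* A homeomorphism of the line preserves orientation iff it is increasing. *)
Definition Rep (R : realType) : set (R -> R) :=
  [set f | homeomorphism f /\ {homo f : a b / a < b}].

Definition Rep_eps (R : realType) (eps : R) : set (R -> R) :=
  [set f | Rep f /\
           forall a b : R, b < a -> `|(f a - f b) / (a - b) - 1| < eps].

Definition standard_shadowing (R : realType) (X : metricType R)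
    (phi : R -> X -> X) : Prop :=
  forall eps : R, 0 < eps -> exists d : R, 0 < d /\
    forall xi : R -> X, pseudotrajectory phi d xi ->
      exists (x : X) (h : R -> R), Rep_eps eps h /\
        forall t : R, mdist (xi t) (phi (h t) x) < eps.

(* Main.v *)
(* Sample a pseudotrajectory of the second flow at integer times and lift the
   samples to a pseudo-orbit of the time-one map of the first flow; the
   interpolated lift is shadowed upstairs, and [P] carries the shadowing orbit
   down.  Away from the singularity the lift is forced, since the inverse of [P]
   is uniformly continuous there.  A visit very near the singularity is long
   when [d] is small, because the singularity is fixed; during it the lift
   follows the closed orbit, and the phase mismatch between entry and exit, at
   most one period, is spread over the whole visit at a negligible cost per unit
   of time. *)
Require Import Defs.
From mathcomp Require Import all_boot all_order all_algebra.
From mathcomp Require Import boolp classical_sets functions reals.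
From mathcomp Require Import topology normedtype.
From mathcomp Require Import lra zify.

Set Implicit Arguments.
Unset Strict Implicit.
Unset Printing Implicit Defensive.

Import Order.TTheory GRing.Theory Num.Theory.
Import numFieldNormedType.Exports.

Local Open Scope classical_set_scope.
Local Open Scope ring_scope.

(** * Uniform estimates from compactness *)

Lemma continuous_mdist (R : realType) (X : topologicalType) (L : metricType R)
    (f g : X -> L) :
  continuous f -> continuous g -> continuous (fun x => mdist (f x) (g x)).
Proof.
move=> cf cg x; apply/cvgrPdist_lt => e e0.
have e20 : 0 < e / 2 by lra.
have nf := metricType_numDomainType.cvgr_dist_lt (cf x) e20.
have ng := metricType_numDomainType.cvgr_dist_lt (cg x) e20.
near=> y.
have fy : mdist (f x) (f y) < e / 2 by near: y; exact: nf.
have gy : mdist (g x) (g y) < e / 2 by near: y; exact: ng.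
have h1 := metric_triangle (f x) (f y) (g x).
have h2 := metric_triangle (f y) (g y) (g x).
have h3 := metric_triangle (f y) (f x) (g y).
have h4 := metric_triangle (f x) (g x) (g y).
move: h1 h2 h3 h4; rewrite (metric_sym (g y)) (metric_sym (f y) (f x)).
by move=> ????; rewrite ltr_norml; apply/andP; split; lra.
Unshelve. all: by end_near. Qed.

Lemma open_continuous_lt (R : realType) (X : topologicalType) (f : X -> R)
    (r : R) :
  continuous f -> open [set x | f x < r].
Proof.
move=> cf; apply: (@open_comp _ _ f [set y | y < r]); last exact: open_lt.
by move=> x _; exact: cf.
Qed.

(* Every uniform estimate below is an instance of this one, for a suitable
   compact set and a suitable pair [f], [O]. *)
Lemma compact_small (R : realType) (X : topologicalType) (C : set X)
    (f : X -> R) (O : set X) :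
    compact C -> continuous f -> open O ->
    (forall x, C x -> f x <= 0 -> O x) ->
  exists2 m : R, 0 < m & forall x, C x -> f x < m -> O x.
Proof.
move=> /compact_near_coveringP cC cf oO fO.
(* Locally in [x] and for small [m > 0]: if [f x <= 0], then [O] is already a neighbourhood of [x];
   otherwise [f] stays above [f x / 2 > m] nearby and the implication is vacuous. *)
have [] := cC R 0^'+ (fun m x => f x < m -> O x).
  move=> x Cx; have [f0|f0] := lerP (f x) 0.
    have nO : \near x, O x by apply: open_nbhs_nbhs; split=> //; exact: fO.
    exists (O, setT); first by split=> //; exact: filterT.
    by case=> x' m [].
  have n1 : \forall x' \near x, f x / 2 < f x'.
    by apply: (cvgr_gt _ (cf x)); lra.
  have f20 : 0 < f x / 2 by lra.
  have n2 : \forall m \near 0^'+, m < f x / 2 by exact: nbhs_right_lt.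
  exists ([set x' | f x / 2 < f x'], [set m | m < f x / 2]); first by split.
  by case=> x' m [/= a b] c; exfalso; lra.
move=> e /= e0 H.
exists (e / 2); first by lra.
move=> x Cx; apply: (H (e / 2)) => //=; last by lra.
by rewrite sub0r normrN gtr0_norm; lra.
Qed.

Lemma compact_continuous_unif (R : realType) (L M : metricType R) (P : L -> M) :
    compact [set: L] -> continuous P -> forall e : R, 0 < e ->
  exists2 d : R, 0 < d & forall u v, mdist u v < d -> mdist (P u) (P v) < e.
Proof.
move=> cL cP e e0.
have [||||d d0 H] := @compact_small R (L * L)%type ([set: L] `*` [set: L])
  (fun q => mdist q.1 q.2) [set q | mdist (P q.1) (P q.2) < e].
- exact: compact_setX.
- by apply: continuous_mdist => q; [exact: cvg_fst|exact: cvg_snd].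
- apply/open_continuous_lt/continuous_mdist => q.
    by apply: (@continuous_comp _ _ _ fst P); [exact: cvg_fst|exact: cP].
  by apply: (@continuous_comp _ _ _ snd P); [exact: cvg_snd|exact: cP].
- move=> [u v] _ /= uv.
  have -> : u = v by apply/(@mdist_positivity R)/le_anti; rewrite uv mdist_ge0.
  by rewrite mdistxx.
by exists d => // u v; exact: (H (u, v)).
Qed.

Lemma continuous_flow (R : realType) (L : metricType R) (phi : R -> L -> L)
    (X : topologicalType) (f : X -> R) (g : X -> L) :
    continuous (fun p : R * L => phi p.1 p.2) -> continuous f -> continuous g ->
  continuous (fun x => phi (f x) (g x)).
Proof.
move=> cphi cf cg x.
apply: (@continuous_comp _ _ _ (fun x => (f x, g x)) (fun p => phi p.1 p.2)).
  exact: (cvg_pair (cf x) (cg x)).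
exact: cphi.
Qed.

(** Negative times are included because [transit_step] runs the flow backwards by one unit. *)
Lemma flow_unif (R : realType) (L : metricType R) (phi : R -> L -> L) :
    topological_flow phi -> forall e : R, 0 < e ->
  exists2 d : R, 0 < d & forall s u v, -1 <= s <= 1 -> mdist u v < d ->
    mdist (phi s u) (phi s v) < e.
Proof.
move=> [cL [cphi _ _]] e e0.
have [||||d d0 H] := @compact_small R (R * (L * L))%type
  (`[-1, 1] `*` ([set: L] `*` [set: L]))
  (fun q => mdist q.2.1 q.2.2) [set q | mdist (phi q.1 q.2.1) (phi q.1 q.2.2) < e].
- by apply: compact_setX; [exact: segment_compact|exact: compact_setX].
- apply: continuous_mdist => q.
    by apply: (@continuous_comp _ _ _ snd fst); [exact: cvg_snd|exact: cvg_fst].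
  by apply: (@continuous_comp _ _ _ snd snd); exact: cvg_snd.
- apply/open_continuous_lt/continuous_mdist => q.
    apply: continuous_flow => // r; first exact: cvg_fst.
    by apply: (@continuous_comp _ _ _ snd fst); [exact: cvg_snd|exact: cvg_fst].
  apply: continuous_flow => // r; first exact: cvg_fst.
  by apply: (@continuous_comp _ _ _ snd snd); exact: cvg_snd.
- move=> [s [u v]] _ /= uv.
  have -> : u = v by apply/(@mdist_positivity R)/le_anti; rewrite uv mdist_ge0.
  by rewrite mdistxx.
exists d => // s u v s1; apply: (H (s, (u, v))).
by rewrite /= in_itv /= s1.
Qed.

Lemma flow_unif_time (R : realType) (L : metricType R) (phi : R -> L -> L) :
    topological_flow phi -> forall e : R, 0 < e ->
  exists2 c : R, 0 < c & forall s u, `|s| < c -> mdist (phi s u) u < e.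
Proof.
move=> [cL [cphi phi0 _]] e e0.
have [||||d d0 H] := @compact_small R (R * L)%type (`[-1, 1] `*` [set: L])
  (fun q => `|q.1|) [set q | mdist (phi q.1 q.2) q.2 < e].
- by apply: compact_setX; [exact: segment_compact|].
- move=> q; apply: (@continuous_comp _ _ _ fst); first exact: cvg_fst.
  exact: norm_continuous.
- apply/open_continuous_lt/continuous_mdist; first exact: cphi.
  by move=> q; exact: cvg_snd.
- by move=> [s u] _ /=; rewrite normr_le0 => /eqP ->; rewrite phi0 mdistxx.
exists (Num.min d 1); first by rewrite lt_min d0 ltr01.
move=> s u; rewrite lt_min => /andP[sd s1]; apply: (H (s, u)) => //.
by split=> //=; rewrite in_itv /= -ler_norml ltW.
Qed.

(** * Runs of integers and interpolation of phases *)

(** The connected component of [n] in [S], empty if [n] is not in [S]. Being the same set for all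
    its members, it can index data attached to a whole run. *)
Definition run (S : set int) (n : int) : set int :=
  [set m | forall i : int, (n <= i <= m) || (m <= i <= n) -> S i].

Lemma run_succ (S : set int) (n : int) : S n -> S (n + 1) ->
  run S (n + 1) = run S n.
Proof.
move=> Sn Sn1; apply/seteqP; split=> m H i Hi.
  have [->|ni] := eqVneq i n; first by [].
  apply: H; lia.
have [->|ni] := eqVneq i (n + 1); first by [].
apply: H; lia.
Qed.

Lemma run_refl (S : set int) (n : int) : S n -> run S n n.
Proof. by move=> Sn i Hi; have -> : i = n by lia. Qed.

(** Used both to push the left end outside a block contained in the run and, applied twice, to show
    that this end is unique. *)
Lemma run_left_end (S : set int) (n a b : int) :
  ~ S a -> run S n (a + 1) -> run S n b -> a < b.
Proof.
move=> Sa Ha Hb; have San : a + 1 <= n.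
  by rewrite leNgt; apply/negP => na; apply/Sa/Ha; lia.
by rewrite ltNge; apply/negP => ba; apply/Sa/Hb; lia.
Qed.

Lemma run_right_end (S : set int) (n a b : int) :
  ~ S a -> run S n (a - 1) -> run S n b -> b < a.
Proof.
move=> Sa Ha Hb; have San : n <= a - 1.
  by rewrite leNgt; apply/negP => na; apply/Sa/Ha; lia.
by rewrite ltNge; apply/negP => ba; apply/Sa/Hb; lia.
Qed.

(** The pair is (intercept, slope). A run bounded on both sides contains a block of radius [N], so
    its length exceeds [N]; a mismatch below [T], spread over it, changes the slope by at most
    [T / N]. *)
Lemma run_line (R : realType) (T : R) (N : nat) (S : set int) (psi : int -> R)
    (n k : int) :
    0 < T -> (0 < N)%N -> S n -> (`|n - k| <= N)%N ->
    (forall m : int, (`|m - k| <= N)%N -> S m) ->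
  exists line : R * R, [/\ `|line.2 - 1| <= T / N%:R,
    forall a : int, ~ S a -> run S n (a + 1) ->
      exists j : int, line.1 + line.2 * a%:~R = psi a + T * j%:~R
  & forall b : int, ~ S b -> run S n (b - 1) ->
      exists j : int, line.1 + line.2 * b%:~R = psi b + T * j%:~R].
Proof.
move=> T0 N0 Sn nk Sk.
have NR : 0 < N%:R :> R by rewrite ltr0n.
have TN : 0 <= T / N%:R by rewrite divr_ge0 // ltW.
have [[a [Sa Ra]]|noa] := pselect (exists a, ~ S a /\ run S n (a + 1));
    have [[b [Sb Rb]]|nob] := pselect (exists b, ~ S b /\ run S n (b - 1)).
- have runk (i : int) : (`|i - k| <= N)%N -> run S n i.
    by move=> ik m Hm; apply: Sk; lia.
  have ak : a < k - N%:Z by apply: (run_left_end Sa Ra); apply: runk; lia.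
  have kb : k + N%:Z < b by apply: (run_right_end Sb Rb); apply: runk; lia.
  have Nba : N%:R <= b%:~R - a%:~R :> R.
    by rewrite -intrB pmulrn ler_int; lia.
  set D : R := b%:~R - a%:~R in Nba.
  have D0 : 0 < D by lra.
  (* [c] is the representative in [[0, T)], modulo [T], of the phase still missing at [b] when one
     starts from [psi a] with slope [1]. *)
  set e := (psi b - psi a - D) / T; pose c := T * (e - (Num.floor e)%:~R).
  have /andP[c0 cT] : 0 <= c < T.
    have := floor_itv e; rewrite intrD => /andP[e1 e2].
    rewrite /c mulr_ge0 /=; [|lra|lra].
    by rewrite gtr_pMr //; lra.
  exists (psi a - (1 + c / D) * a%:~R, 1 + c / D); split=> /=.
  + rewrite addrAC subrr add0r ger0_norm ?divr_ge0 ?(ltW D0) //.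
    apply: (@le_trans _ _ (T / D)).
      by rewrite ler_pM2r ?invr_gt0 ?ltW.
    by rewrite ler_pM2l // lef_pV2.
  + move=> a' Sa' Ra'; exists 0.
    have -> : a' = a.
      have := run_left_end Sa Ra Ra'; have := run_left_end Sa' Ra' Ra; lia.
    by rewrite mulr0 addr0 subrK.
  + move=> b' Sb' Rb'; exists (- Num.floor e).
    have -> : b' = b.
      have := run_right_end Sb Rb Rb'; have := run_right_end Sb' Rb' Rb; lia.
    have -> : psi a - (1 + c / D) * a%:~R + (1 + c / D) * b%:~R
        = psi a + D + c by rewrite -[X in _ = _ + _ + X](divfK (lt0r_neq0 D0)) /D; lra.
    rewrite /c /e mulrBr mulrCA divff ?lt0r_neq0 // mulr1 mulrNz; lra.
(* With at most one end there is no mismatch to absorb, and slope [1] works. *)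
- exists (psi a - a%:~R, 1); split=> /=.
  + by rewrite subrr normr0.
  + move=> a' Sa' Ra'; exists 0.
    have -> : a' = a.
      have := run_left_end Sa Ra Ra'; have := run_left_end Sa' Ra' Ra; lia.
    by lra.
  + by move=> b Sb Rb; case: nob; exists b.
- exists (psi b - b%:~R, 1); split=> /=.
  + by rewrite subrr normr0.
  + by move=> a Sa Ra; case: noa; exists a.
  + move=> b' Sb' Rb'; exists 0.
    have -> : b' = b.
      have := run_right_end Sb Rb Rb'; have := run_right_end Sb' Rb' Rb; lia.
    by lra.
- exists (0, 1); split=> /=.
  + by rewrite subrr normr0.
  + by move=> a Sa Ra; case: noa; exists a.
  + by move=> b Sb Rb; case: nob; exists b.
Qed.

(* On each run of [S] the phase [theta] is affine with slope close to [1], so as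
   to agree modulo [T] with [psi] at both ends. *)
Lemma phase_interpolation (R : realType) (T : R) (N : nat) (S : set int)
    (psi : int -> R) :
    0 < T -> (0 < N)%N ->
    (forall n : int, S n -> exists k : int, (`|n - k| <= N)%N /\
       forall m : int, (`|m - k| <= N)%N -> S m) ->
  exists theta : int -> R, (forall n, ~ S n -> theta n = psi n) /\
    forall n, S n \/ S (n + 1) -> exists j : int,
      `|theta (n + 1) - theta n - 1 - T * j%:~R| <= T / N%:R.
Proof.
move=> T0 N0 HS.
have TN : 0 <= T / N%:R by rewrite divr_ge0 // ltW.
pose good (n : int) (l : R * R) := [/\ `|l.2 - 1| <= T / N%:R,
    forall a : int, ~ S a -> run S n (a + 1) ->
      exists j : int, l.1 + l.2 * a%:~R = psi a + T * j%:~R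
  & forall b : int, ~ S b -> run S n (b - 1) ->
      exists j : int, l.1 + l.2 * b%:~R = psi b + T * j%:~R].
(* The line is chosen as a function of the run, not of [n], so that all members of a run share
   it. *)
have [|F HF] := @choice (set int) (R * R)%type
    (fun C l => forall n, S n -> C = run S n -> good n l).
  move=> C.
  have [[n [Sn ->]]|no] := pselect (exists n, S n /\ C = run S n).
    have [k [nk Sk]] := HS n Sn.
    have [l Hl] := run_line psi T0 N0 Sn nk Sk.
    by exists l => m Sm Em; move: Hl; rewrite /good Em.
  by exists (0, 0) => n Sn En; case: no; exists n.
pose theta n := if `[<S n>] then (F (run S n)).1 + (F (run S n)).2 * n%:~R
                else psi n.
have thS n : S n -> theta n = (F (run S n)).1 + (F (run S n)).2 * n%:~R.
  by move=> Sn; rewrite /theta asboolT.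
have thN n : ~ S n -> theta n = psi n.
  by move=> Sn; rewrite /theta asboolF.
exists theta; split=> // n Sor.
have [Sn|Sn] := pselect (S n); have [Sn1|Sn1] := pselect (S (n + 1)).
- exists 0; rewrite !thS // run_succ //.
  have [H _ _] := HF _ n Sn erefl.
  rewrite intrD (_ : _ - _ = (F (run S n)).2 - 1) //; lra.
(* On leaving or entering [S], the line prolonged by one step meets [psi] modulo [T], so the
   increment is again the slope up to a multiple of [T]. *)
- have [H _ /(_ (n + 1) Sn1)[|j Ej]] := HF _ n Sn erefl.
    by rewrite addrK; exact: run_refl.
  exists (- j); rewrite thN // thS //.
  move: Ej; rewrite intrD => Ej; rewrite mulrNz.
  rewrite (_ : _ - _ = (F (run S n)).2 - 1) //; lra.
- have [H /(_ n Sn (run_refl Sn1))[j Ej] _] := HF _ (n + 1) Sn1 erefl.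
  exists j; rewrite (thN n) // thS // intrD.
  rewrite (_ : _ - _ = (F (run S (n + 1))).2 - 1) //; lra.
- by case: Sor.
Qed.

(** * Long visits near the singularity *)

Lemma transit_step (R : realType) (L : metricType R) (phi : R -> L -> L)
    (p : L) (rho : R) :
    topological_flow phi -> singularity phi p -> 0 < rho ->
  exists2 d : R, 0 < d <= rho & forall y : int -> L,
    (forall n, mdist (phi 1 (y n)) (y (n + 1)) < d) ->
    forall k m : int, (`|m - k| <= 1)%N -> mdist (y k) p < d ->
      mdist (y m) p < rho.
Proof.
move=> flow sing rho0; have [_ [_ phi0 phiD]] := flow.
have rho2 : 0 < rho / 2 by lra.
have [e e0 He] := flow_unif flow rho2.
have {}He s u : s = 1 \/ s = -1 -> mdist u p < e -> mdist (phi s u) p < rho / 2.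
  by move=> Hs /(He s); rewrite sing; apply; case: Hs => ->; lra.
exists (Num.min (rho / 2) (e / 2)).
  have e2 : 0 < e / 2 by lra.
  have le_rho : rho / 2 <= rho by lra.
  by rewrite lt_min rho2 e2 ge_min le_rho.
move=> y Hy k m mk; rewrite !lt_min => /andP[k1 k2].
have [->|[->|mE]] : m = k \/ m = k + 1 \/ k = m + 1 by lia.
- lra.
- have := Hy k; rewrite lt_min => /andP[y1 y2].
  have h : mdist (phi 1 (y k)) p < rho / 2 by apply: He; [left|lra].
  have := metric_triangle (y (k + 1)) (phi 1 (y k)) p.
  by rewrite (metric_sym (y (k + 1)) (phi 1 (y k))); lra.
(* Backward step: [phi 1 (y m)] is close to [y k], hence to [p], and time [-1] takes it back to
   [y m] while fixing [p]. *)
- have := Hy m; rewrite lt_min -mE => /andP[y1 y2].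
  have h : mdist (phi 1 (y m)) p < e.
    by have := metric_triangle (phi 1 (y m)) (y k) p; lra.
  have := He (-1) _ (or_intror erefl) h.
  by rewrite -phiD addNr phi0; lra.
Qed.

(** Read contrapositively: a pseudo-orbit that comes within [d] of [p] needs more than [N] steps to
    leave the [rho]-ball, in either time direction. *)
Lemma transit (R : realType) (L : metricType R) (phi : R -> L -> L)
    (p : L) (rho : R) (N : nat) :
    topological_flow phi -> singularity phi p -> 0 < rho ->
  exists2 d : R, 0 < d <= rho & forall y : int -> L,
    (forall n, mdist (phi 1 (y n)) (y (n + 1)) < d) ->
    forall k m : int, (`|m - k| <= N)%N -> mdist (y k) p < d ->
      mdist (y m) p < rho.
Proof.
move=> flow sing rho0.
elim: N => [|N [d1 /andP[d10 d1r] IH]].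
  exists rho; first by rewrite rho0 lexx.
  by move=> y _ k m mk; have -> : m = k by lia.
have [d /andP[d0 dd1] Hd] := transit_step flow sing d10.
exists d; first by rewrite d0 (le_trans dd1).
move=> y Hy k m mk yk.
have [l lk ml] : exists2 l : int, (`|l - k| <= 1)%N & (`|m - l| <= N)%N.
  have [km|km|km] := ltgtP k m; [exists (k + 1)|exists (k - 1)|exists k]; lia.
apply: (IH y _ l m ml) => [n|]; first exact: lt_le_trans (Hy n) dd1.
exact: (Hd y Hy k).
Qed.

(** * Uniform estimates for the inverse and the fibre of the projection *)

(** Pairs with equal images are diagonal or lie over [p]. Adding the pairs with [P v] within [r] of
    [p] to a neighbourhood of the diagonal gives an open set containing all of them, and compactness
    applies. *)
Lemma inverse_unif (R : realType) (L M : metricType R) (P : L -> M) (p : M)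
    (r e : R) :
    compact [set: L] -> continuous P -> 0 < r -> 0 < e ->
    (forall u v, P v <> p -> P u = P v -> u = v) ->
  exists2 d : R, 0 < d & forall u v, r <= mdist (P v) p ->
    mdist (P u) (P v) < d -> mdist u v < e.
Proof.
move=> cL cP r0 e0 Pinj.
have cfst : continuous (fun q : L * L => P q.1).
  by move=> q; apply: (@continuous_comp _ _ _ fst P); [exact: cvg_fst|exact: cP].
have csnd : continuous (fun q : L * L => P q.2).
  by move=> q; apply: (@continuous_comp _ _ _ snd P); [exact: cvg_snd|exact: cP].
have [||||d d0 H] := @compact_small R (L * L)%type ([set: L] `*` [set: L])
  (fun q => mdist (P q.1) (P q.2))
  ([set q | mdist (P q.2) p < r] `|` [set q | mdist q.1 q.2 < e]).
- exact: compact_setX.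
- exact: continuous_mdist.
- apply: openU; apply/open_continuous_lt/continuous_mdist => // q.
  + exact: cst_continuous.
  + exact: cvg_fst.
  + exact: cvg_snd.
- move=> [u v] _ /= uv.
  have {}uv : P u = P v by apply/(@mdist_positivity R)/le_anti; rewrite uv mdist_ge0.
  have [vp|vp] := pselect (P v = p); first by left; rewrite vp mdistxx.
  by right; rewrite (Pinj u v) // mdistxx.
exists d => // u v vr uv.
by have [|/=|//] := H (u, v) _ uv; [by []|rewrite ltNge vr].
Qed.

(** The [e]-balls around the points [g t] cover the compact fibre over [p], hence also the preimage
    of a small ball around [p]. *)
Lemma fiber_unif (R : realType) (L M : metricType R) (P : L -> M) (p : M)
    (g : R -> L) (e : R) :
    compact [set: L] -> continuous P -> 0 < e ->
    (forall u, P u = p -> exists t, u = g t) ->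
  exists2 d : R, 0 < d & forall u, mdist (P u) p < d ->
    exists t, mdist u (g t) < e.
Proof.
move=> cL cP e0 Pg.
have [|||d d0 H] := @compact_small R L [set: L] (fun u => mdist (P u) p)
  (\bigcup_(t in [set: R]) [set u | mdist u (g t) < e]) cL.
- by apply: continuous_mdist => // q; exact: cst_continuous.
- apply: bigcup_open => t _; apply/open_continuous_lt/continuous_mdist => q //.
  exact: cst_continuous.
- move=> u _ /= up.
  have {}up : P u = p by apply/(@mdist_positivity R)/le_anti; rewrite up mdist_ge0.
  by have [t ->] := Pg u up; exists t; rewrite //= mdistxx.
by exists d => // u ud; have [t _] := H u I ud; exists t.
Qed.

(** * Interpolation and lifting of pseudo-orbits *)

Lemma flow_periodic (R : realType) (L : metricType R) (phi : R -> L -> L)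
    (x : L) (T : R) (j : int) :
  is_flow phi -> phi T x = x -> phi (T * j%:~R) x = x.
Proof.
move=> [_ phi0 phiD] phiT.
have H (n : nat) : phi (T * n%:R) x = x.
  elim: n => [|n IH]; first by rewrite mulr0 phi0.
  by rewrite -natr1 mulrDr mulr1 phiD phiT.
case: j => n; first exact: H.
rewrite NegzE mulrNz mulrN -{1}(H n.+1) -phiD pmulrn addNr; exact: phi0.
Qed.

(** The interpolation follows exact orbits between integers, and a time step of at most [1] crosses
    at most one integer. The jump there is below [d], and the flow carries it to an error below
    [e]. *)
Lemma pseudotrajectory_interpolation (R : realType) (L : metricType R)
    (phi : R -> L -> L) (z : int -> L) (d e : R) :
    is_flow phi -> 0 < e ->
    (forall s u v, -1 <= s <= 1 -> mdist u v < d ->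
       mdist (phi s u) (phi s v) < e) ->
    (forall n, mdist (phi 1 (z n)) (z (n + 1)) < d) ->
  pseudotrajectory phi e
    (fun t => phi (t - (Num.floor t)%:~R) (z (Num.floor t))).
Proof.
move=> [_ phi0 phiD] e0 He Hz t s /andP[s0 s1].
have := floor_itv t; set n := Num.floor t; rewrite intrD => /andP[nt tn].
have [ts|ts] := ltrP (t + s) (n%:~R + 1).
  have -> : Num.floor (t + s) = n by apply: floor_def; rewrite intrD; lra.
  by rewrite -phiD (addrC t) addrA mdistxx.
have -> : Num.floor (t + s) = n + 1.
  by apply: floor_def; rewrite !intrD; lra.
rewrite -phiD.
have -> : s + (t - n%:~R) = t + s - (n + 1)%:~R + 1 by rewrite intrD; lra.
rewrite metric_sym (phiD _ 1); apply: He; last exact: Hz.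
by rewrite intrD; lra.
Qed.

Lemma distn_succ_le (n k : int) (N : nat) :
  (`|n - k| <= N)%N -> (`|(n + 1 - k)%R| <= N.+1)%N.
Proof. lia. Qed.

Lemma distn_le_succ (n k : int) (N : nat) :
  (`|(n + 1 - k)%R| <= N)%N -> (`|n - k| <= N.+1)%N.
Proof. lia. Qed.

Lemma lift_pseudo_orbit (R : realType) (L1 L2 : metricType R)
    (phi1 : R -> L1 -> L1) (phi2 : R -> L2 -> L2) (P : L1 -> L2) (x0 : L1)
    (T e1 e2 : R) :
    topological_flow phi1 -> topological_flow phi2 -> continuous P ->
    set_surj [set: L1] [set: L2] P ->
    (forall t x, P (phi1 t x) = phi2 t (P x)) ->
    0 < T -> phi1 T x0 = x0 -> singularity phi2 (P x0) ->
    (forall u, P u = P x0 -> exists t, u = phi1 t x0) ->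
    (forall u v, P v <> P x0 -> P u = P v -> u = v) ->
    0 < e1 -> 0 < e2 ->
  exists2 d : R, 0 < d & forall y : int -> L2,
    (forall n, mdist (phi2 1 (y n)) (y (n + 1)) < d) ->
    exists z : int -> L1,
      (forall n, mdist (phi1 1 (z n)) (z (n + 1)) < e1) /\
      forall n, mdist (P (z n)) (y n) < e2.
Proof.
move=> flow1 flow2 Pcont Psurj Psemi T0 phiT sing fib Pinj e10 e20.
have [cL1 isflow1] := flow1; have [_ _ phi1D] := isflow1.
set p := P x0 in sing fib Pinj.
have e13 : 0 < e1 / 3 by lra.
have [d1 d10 Hd1] := flow_unif flow1 e13.
have [c c0 Hc] := flow_unif_time flow1 e13.
pose d2 := Num.min d1 (e1 / 3).
have d20 : 0 < d2 by rewrite lt_min d10 e13.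
have [r0 r00 Hr0] := fiber_unif cL1 Pcont d20 fib.
pose r1 := Num.min r0 e2.
have r10 : 0 < r1 by rewrite lt_min r00 e20.
have [N N0 TN] : exists2 N : nat, (0 < N)%N & T / N%:R < c.
  exists (Num.truncn (T / c)).+1 => //.
  rewrite ltr_pdivrMr ?ltr0n // mulrC -ltr_pdivrMr //.
  exact: truncnS_gt.
(* [N.+1] rather than [N]: the indices just outside a block of radius [N], where the lift enters or
   leaves the closed orbit, must be near the singularity too. *)
have [r /andP[rpos rr1] Hr] := transit N.+1 flow2 sing r10.
have [d3 d30 Hd3] := inverse_unif cL1 Pcont rpos e10 Pinj.
exists (Num.min r d3); first by rewrite lt_min rpos d30.
move=> y Hy.
have {}Hr k m : (`|m - k| <= N.+1)%N -> mdist (y k) p < r -> mdist (y m) p < r1.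
  by apply: Hr => n; move: (Hy n); rewrite lt_min => /andP[].
have [Q HQ] : {Q : int -> L1 & forall n, P (Q n) = y n}.
  apply: (@choice _ _ (fun n u => P u = y n)) => n.
  by have [u _ <-] := Psurj (y n) I; exists u.
have [psi Hpsi] : {psi : int -> R & forall n, mdist (y n) p < r0 ->
    mdist (Q n) (phi1 (psi n) x0) < d2}.
  apply: (@choice _ _ (fun n t => mdist (y n) p < r0 ->
    mdist (Q n) (phi1 t x0) < d2)) => n; have [yn|yn] := pselect (mdist (y n) p < r0).
    by have [|t Ht] := Hr0 (Q n); [rewrite HQ|exists t].
  (* Arbitrary phase: far from [p], [w n] is never compared with [z n]. *)
  by exists 0.
(* Close approaches are thickened by [N] on each side, so every run of [S] is long enough for
   [phase_interpolation]. *)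
pose S := [set n : int | exists2 k : int, (`|n - k| <= N)%N & mdist (y k) p < r].
have SN n : S n -> exists k : int, (`|n - k| <= N)%N /\
    forall m : int, (`|m - k| <= N)%N -> S m.
  by move=> [k nk yk]; exists k; split=> // m mk; exists k.
have [theta [thN thS]] := phase_interpolation psi T0 N0 SN.
pose w n := phi1 (theta n) x0.
pose z n := if `[<S n>] then w n else Q n.
have zS n : S n -> z n = w n by move=> Sn; rewrite /z asboolT.
have zN n : ~ S n -> z n = Q n by move=> Sn; rewrite /z asboolF.
have zw n k : (`|n - k| <= N.+1)%N -> mdist (y k) p < r ->
    mdist (z n) (w n) < d2.
  move=> nk yk; have [Sn|Sn] := pselect (S n).
    by rewrite zS // mdistxx.
  rewrite zN // /w thN //; apply: Hpsi.
  by move: (Hr _ _ nk yk); rewrite lt_min => /andP[].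
exists z; split=> n; last first.
  have [Sn|Sn] := pselect (S n); last by rewrite zN // HQ mdistxx.
  have [k nk yk] := Sn.
  (* The closed orbit projects to [p], and [y n] is within [r1 <= e2] of [p]. *)
  rewrite zS // /w Psemi sing metric_sym.
  by move: (Hr _ _ (leqW nk) yk); rewrite lt_min => /andP[].
have [Sn|Sn] := pselect (S n \/ S (n + 1)).
  have [j Hj] := thS n Sn.
  have [k [nk n1k yk]] : exists k : int, [/\ (`|n - k| <= N.+1)%N,
      (`|(n + 1 - k)%R| <= N.+1)%N & mdist (y k) p < r].
    case: Sn => -[k nk yk]; exists k.
      by split; [exact: leqW|exact: distn_succ_le|].
    by split; [exact: distn_le_succ|exact: leqW|].
  have := zw _ _ nk yk; rewrite lt_min => /andP[zw1 _].
  have := zw _ _ n1k yk; rewrite lt_min => /andP[_ zw2].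
  have {}zw1 : mdist (phi1 1 (z n)) (phi1 1 (w n)) < e1 / 3.
    by apply: Hd1 => //; lra.
  (* The phase error modulo [T], below [c] in size; periodicity discards [T * j]. The three thirds
     of [e1] pay for passing from [z n] to [w n] before the time-one map, for the shift by [s], and
     for returning from [w (n + 1)] to [z (n + 1)]. *)
  pose s := theta (n + 1) - theta n - 1 - T * j%:~R.
  have ws : w (n + 1) = phi1 s (phi1 1 (w n)).
    rewrite /w -!phi1D -{2}(flow_periodic j isflow1 phiT) -phi1D.
    by congr (phi1 _ _); rewrite /s; lra.
  have := Hc s (phi1 1 (w n)) (le_lt_trans Hj TN); rewrite -ws => ww.
  have := metric_triangle (phi1 1 (z n)) (phi1 1 (w n)) (z (n + 1)).
  have := metric_triangle (phi1 1 (w n)) (w (n + 1)) (z (n + 1)).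
  rewrite (metric_sym (phi1 1 (w n)) (w (n + 1))).
  by rewrite (metric_sym (w (n + 1)) (z (n + 1))); lra.
have [Sn0 Sn1] : ~ S n /\ ~ S (n + 1).
  by split=> ?; apply: Sn; [left|right].
(* Away from [S] both lifts are the chosen preimages, and [y (n + 1)] is at least [r] from [p], so
   closeness below lifts. *)
apply: Hd3; rewrite !zN // ?Psemi ?HQ.
  by rewrite leNgt; apply/negP => yn; apply: Sn1; exists (n + 1); rewrite ?subrr.
by move: (Hy n); rewrite lt_min => /andP[].
Qed.

(** * Descent of shadowing to the factor *)

Theorem theorem1p3 (R : realType) (L1 L2 : metricType R)
    (phi1 : R -> L1 -> L1) (phi2 : R -> L2 -> L2)
    (flow1 : topological_flow phi1) (flow2 : topological_flow phi2)
    (P : L1 -> L2)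
    (Pcont : continuous P)
    (Psurj : set_surj [set: L1] [set: L2] P)
    (Psemi : forall (t : R) (x : L1), P (phi1 t x) = phi2 t (P x))
    (Pgamma : exists gamma : set L1,
        [/\ closed_orbit phi1 gamma,
            exists p : L2, P @` gamma = [set p] /\ singularity phi2 p
          & set_bij (~` gamma) (~` (P @` gamma)) P]) :
  standard_shadowing phi1 -> standard_shadowing phi2.
Proof.
move=> shadow1 eps eps0.
have [gamma [[x0 [gammaE [T [T0 phiT _]]]] [p [Pgp sing]] [Pfun Pinj _]]] := Pgamma.
have [cL1 isflow1] := flow1; have [_ phi10 _] := isflow1.
have px0 : P x0 = p.
  have : (P @` gamma) (P x0) by exists x0; rewrite // gammaE; exists 0.
  by rewrite Pgp.
rewrite -px0 in Pgp sing.
have fib u : P u = P x0 -> exists t, u = phi1 t x0.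
  move=> Pu; have [|ug] := pselect (gamma u).
    by rewrite gammaE => -[t _ <-]; exists t.
  by have := Pfun u ug; rewrite Pgp /= Pu.
(* Injectivity off [gamma] suffices: [P u = P v <> P x0] forces both points off [gamma]. *)
have inj u v : P v <> P x0 -> P u = P v -> u = v.
  have nog q : P q <> P x0 -> (~` gamma) q.
    by move=> Pq gq; apply: Pq; have : (P @` gamma) (P q); [exists q|rewrite Pgp].
  move=> Pv Puv; apply: Pinj => //; apply/mem_set/nog => //.
  by rewrite Puv.
have eps2 : 0 < eps / 2 by lra.
have eps4 : 0 < eps / 4 by lra.
have [a a0 Ha] := compact_continuous_unif cL1 Pcont eps2.
(* [a] controls distances after applying [P]; [eps] lets the same reparametrization [h] serve
   below. *)
have [|d1 [d10 Hd1]] := shadow1 (Num.min a eps); first by rewrite lt_min a0 eps0.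
have [b1 b10 Hb1] := flow_unif flow1 d10.
have [b2 b20 Hb2] := flow_unif flow2 eps4.
have [d d0 Hd] := lift_pseudo_orbit flow1 flow2 Pcont Psurj Psemi T0 phiT sing
  fib inj b10 b20.
exists (Num.min d (eps / 4)); split; first by rewrite lt_min d0 eps4.
move=> xi Hxi.
have Hxi1 t s : 0 <= s <= 1 ->
    mdist (xi (t + s)) (phi2 s (xi t)) < d /\
    mdist (xi (t + s)) (phi2 s (xi t)) < eps / 4.
  by move=> /(Hxi t); rewrite lt_min => /andP[].
have [n|z [zstep zy]] := Hd (fun n : int => xi n%:~R).
  rewrite metric_sym intrD.
  by have [] := Hxi1 n%:~R 1; first lra.
have eta := pseudotrajectory_interpolation isflow1 d10 Hb1 zstep.
have [x [h [[Rh Hh] xh]]] := Hd1 _ eta.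
exists (P x), h; split.
  by split=> // u v /(Hh u v); rewrite lt_min => /andP[].
move=> t; have := xh t; rewrite lt_min => /andP[/Ha + _].
have := floor_itv t; set n := Num.floor t; rewrite intrD => /andP[nt tn].
rewrite !Psemi.
have tn1 : -1 <= t - n%:~R <= 1 by lra.
have tn0 : 0 <= t - n%:~R <= 1 by lra.
have h1 := Hb2 _ _ _ tn1 (zy n).
have [_] := Hxi1 n%:~R _ tn0; rewrite addrC subrK => h2 h3.
(* The budget is [eps / 4] for [xi] against the orbit of its last integer sample, [eps / 4] for that
   sample against its lift, and [eps / 2] for the projected shadowing. *)
have := metric_triangle (xi t) (phi2 (t - n%:~R) (xi n%:~R)) (phi2 (h t) (P x)).
have := metric_triangle (phi2 (t - n%:~R) (xi n%:~R))
  (phi2 (t - n%:~R) (P (z n))) (phi2 (h t) (P x)).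
rewrite (metric_sym (phi2 (t - n%:~R) (xi n%:~R)) (phi2 (t - n%:~R) (P (z n)))).
by lra.
Qed.
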